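(* Let $M$ be a simplicial complex on $[m]$ and let $(\underline{K},\underline{L}) = \{(K_i, L_i)\}_{i \in [m]}$ be a family of pairs of simplicial complexes. Suppose that $M$ is shellable and that for any $i \in [m]$: - there exists $\alpha_i \in \mathbf{F}_{K_i}$ such that $\mathbf{F}_{L_i} \subset \{ \alpha_i \setminus \{x\} : x \in \alpha_i\}$, and - $K_i$ is shellable with a shelling $<_i$ such that $\alpha_i$ is the minimum element with respect to $<_i$. Then $\mathcal{Z}^*_M(\underline{K},\underline{L})$ is shellable.
   Context: A simplicial complex $K$ is a collection of finite subsets (simplices) of a set $V(K)$ closed under taking subsets, with $\{v\}\in K$ for all $v\in V(K)$. The dimension is $\dim K=\max_{\sigma\in K}|\sigma|-1$; all simplicial complexes are nonempty (they contain $\emptyset$) and finite-dimensional. A facet is an inclusion-maximal simplex; $\mathbf{F}_X$ denotes the set of all facets of $X$. A complex is pure if all its facets have the same cardinality. A pair $(K,L)$ of simplicial complexes consists of a simplicial complex $K$ and a subcomplex $L$ of $K$ (so $V(L)\subset V(K)$). $K$ is shellable (in the non-pure sense) if its facets can be arranged in a linear order $F_1,\dots,F_t$ (a shelling) such that for all $k=2,\dots,t$ the subcomplex $\left(\bigcup_{i=1}^{k-1}\langle F_i\rangle\right)\cap\langle F_k\rangle$ is pure and $(|F_k|-2)$-dimensional, where $\langle F\rangle$ is the complex of all subsets of $F$. A shelling is also regarded as a linear order relation on the set of facets. The join of $K_1,\dots,K_m$ is $K_1*\cdots*K_m=\{\sigma\subset\bigsqcup_{i}V(K_i) : \sigma\cap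 V(K_i)\in K_i \text{ for all } i\}$. Let $M$ be a simplicial complex with vertex set $[m]=\{1,\dots,m\}$, $m\ge1$. The polyhedral join is the subcomplex $\mathcal{Z}^*_M(\underline{K},\underline{L})=\bigcup_{S\in M}X^S_1*\cdots*X^S_m$ of $K_1*\cdots*K_m$, where $X^S_i=K_i$ if $i\in S$ and $X^S_i=L_i$ if $i\notin S$. *)

(* Defs.v *)
From HB Require Import structures.
From mathcomp Require Import all_boot all_order all_algebra.
From mathcomp Require Import finmap.
From mathcomp Require Import boolp classical_sets.

Set Implicit Arguments.
Unset Strict Implicit.
Unset Printing Implicit Defensive.

Import GRing.Theory.

Local Open Scope ring_scope.
Local Open Scope classical_set_scope.

(* V is an ambient type of labels: the vertex set is [vertices K], which may be
   a proper subset of V, so that no label is forced to be a vertex. *)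
Record complex (V : choiceType) := Complex {
  faces :> set {fset V};
  complex_nonempty : faces !=set0;
  complex_closed : forall s t : {fset V},
    (t `<=` s)%fset -> faces s -> faces t;
  complex_findim : exists d : nat, forall s, faces s -> (#|` s| <= d)%N
}.

Section SimplicialComplexes.
Variable V : choiceType.
Implicit Types (X : set {fset V}) (K : complex V) (F G s : {fset V}).

Definition vertices K : set V := [set v | faces K [fset v]%fset].

Definition facets X : set {fset V} :=
  [set F | X F /\ forall G, X G -> (F `<=` G)%fset -> F = G].

Definition pure X : Prop :=
  forall F G, facets X F -> facets X G -> #|` F| = #|` G|.

(* The dimension is an integer: the complex whose only face is the empty set
   has dimension -1. *)
Definition has_dim X (d : int) : Prop :=
  (exists2 s, X s & #|` s|%:Z - 1 = d) /\
  (forall s, X s -> #|` s|%:Z - 1 <= d).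

Definition simplex F : set {fset V} := [set s | (s `<=` F)%fset].

(* The list Fs is 0-indexed, so that the condition bears on all its terms but
   the first. *)
Definition shelling K (Fs : seq {fset V}) : Prop :=
  [/\ uniq Fs,
      [set` Fs] = facets K &
      forall k : nat, (0 < k < size Fs)%N ->
        let Fk := nth fset0 Fs k in
        let X := (\bigcup_(i < k) simplex (nth fset0 Fs i)) `&` simplex Fk in
        pure X /\ has_dim X (#|` Fk|%:Z - 2)].

Definition shellable K : Prop := exists Fs, shelling K Fs.

(* The linear order on the facets given by their positions in the shelling. *)
Definition shelling_le (Fs : seq {fset V}) : rel {fset V} :=
  fun F G => (index F Fs <= index G Fs)%N.

Definition shelling_min K (Fs : seq {fset V}) F : Prop :=
  facets K F /\ forall G, facets K G -> shelling_le Fs F G.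

End SimplicialComplexes.

Section PolyhedralJoin.
Variables (m : nat) (V : 'I_m -> choiceType).

(* The disjoint union of the vertex sets lives in {i : 'I_m & V i}, and
   [slice i s] is the intersection of s with its i-th summand. *)
Definition slice (i : 'I_m) (s : {fset {j : 'I_m & V j}}) : {fset V i} :=
  [fset v in pmap (untag None (fun v : V i => Some v)) s]%fset.

Lemma in_slice i s (v : V i) : (v \in slice i s) = (Tagged V v \in s).
Proof.
rewrite inE /= mem_pmap; apply/mapP/idP => [[u us]|vs]; last first.
  by exists (Tagged V v) => //; rewrite untagE.
by rewrite /untag; case: eqP => // e [->]; rewrite etaggedK.
Qed.

Lemma slice_sub i s t : (t `<=` s)%fset -> (slice i t `<=` slice i s)%fset.
Proof. by move=> /fsubsetP ts; apply/fsubsetP => v; rewrite !in_slice; apply: ts. Qed.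

Lemma slice0 i : slice i fset0 = fset0.
Proof. by apply/fsetP => v; rewrite in_slice !inE. Qed.

Lemma card_slice s : #|` s| = (\sum_(i < m) #|` slice i s|)%N.
Proof.
have cardE i : #|` slice i s| = count (fun u => tag u == i) s.
  rewrite /slice card_fseq undup_id; last first.
    apply: (@pmap_uniq _ _ _ (Tagged V)) (fset_uniq s) => u.
    by rewrite /untag; case: eqP => //= e; case: u e => j w /= e; case: _ / e.
  rewrite size_pmap; apply: eq_count => u /=.
  by rewrite /untag; case: eqP.
under eq_bigr do rewrite cardE -sum1_count big_mkcond /=.
rewrite exchange_big /= -sum1_size; apply: eq_bigr => u _.
by rewrite -big_mkcond (big_pred1 (tag u)) // => i; rewrite eq_sym.
Qed.

Lemma slice_findim (d : 'I_m -> nat) s :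
  (forall i, #|` slice i s| <= d i)%N -> (#|` s| <= \sum_(i < m) d i)%N.
Proof. by move=> le_d; rewrite card_slice; apply: leq_sum. Qed.

Section Join.
Variable X : forall i, complex (V i).

Definition join_faces : set {fset {i : 'I_m & V i}} :=
  [set s | forall i, faces (X i) (slice i s)].

Lemma join_nonempty : join_faces !=set0.
Proof.
exists fset0 => i; rewrite slice0; have [s Xs] := complex_nonempty (X i).
exact: complex_closed (fsub0set s) Xs.
Qed.

Lemma join_closed (s t : {fset {i : 'I_m & V i}}) :
  (t `<=` s)%fset -> join_faces s -> join_faces t.
Proof. by move=> ts Xs i; apply: complex_closed (slice_sub i ts) (Xs i). Qed.

Lemma join_findim :
  exists d : nat, forall s, join_faces s -> (#|` s| <= d)%N.
Proof.
have /all_sig[d dP] i := cid (complex_findim (X i)).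
by exists (\sum_(i < m) d i)%N => s Xs; apply: slice_findim => i; apply: dP.
Qed.

Definition join : complex {i : 'I_m & V i} :=
  Complex join_nonempty join_closed join_findim.

End Join.

Section Polyhedral.
Variables (M : complex 'I_m) (K L : forall i, complex (V i)).

Definition poly_join_faces : set {fset {i : 'I_m & V i}} :=
  \bigcup_(S in faces M) join (fun i => if i \in S then K i else L i).

Lemma poly_join_nonempty : poly_join_faces !=set0.
Proof.
have [S MS] := complex_nonempty M.
have [s ss] := complex_nonempty (join (fun i => if i \in S then K i else L i)).
by exists s, S.
Qed.

Lemma poly_join_closed (s t : {fset {i : 'I_m & V i}}) :
  (t `<=` s)%fset -> poly_join_faces s -> poly_join_faces t.
Proof. by move=> ts [S MS Ss]; exists S => //; apply: complex_closed ts Ss. Qed.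

Lemma poly_join_findim :
  exists d : nat, forall s, poly_join_faces s -> (#|` s| <= d)%N.
Proof.
have /all_sig[dK dKP] i := cid (complex_findim (K i)).
have /all_sig[dL dLP] i := cid (complex_findim (L i)).
exists (\sum_(i < m) maxn (dK i) (dL i))%N => s [S _ Ss].
apply: slice_findim => i; rewrite leq_max; move: (Ss i).
by case: ifP => _ => [/dKP ->//|/dLP ->]; rewrite orbT.
Qed.

Definition poly_join : complex {i : 'I_m & V i} :=
  Complex poly_join_nonempty poly_join_closed poly_join_findim.

Lemma poly_join_sub :
  (forall i, L i `<=` K i) -> poly_join `<=` join K.
Proof. by move=> LK s [S _ Ss] i; move: (Ss i); case: ifP => // _ /LK. Qed.

End Polyhedral.
End PolyhedralJoin.

(* Main.v *)
(* Order the facets of the polyhedral join first by the facet S of M they come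
   from, and then by the sum of the positions of their components in the
   shellings of the K_i and in arbitrary orders of the facets of the L_i; ties
   are broken arbitrarily.  Shellability amounts to an exchange property: for
   A before B there are a facet C before B and x in B \ A with B \ x in C.

   If A and B come from the same S, some component of A strictly precedes that
   of B, and one exchanges in that component alone.  Otherwise the shelling of
   M yields S' before S and v in S, absent from the facet of A, with S \ v in
   S', and A_v = alpha_v \ x.  If B_v is not alpha_v, then alpha_v precedes it
   and one exchanges against alpha_v inside K_v.  If B_v = alpha_v, take C over
   S' with C_v = A_v and every new component equal to alpha_i, which contains
   the facet B_i of L_i. *)
Require Import Defs.
From mathcomp Require Import all_boot finmap.
From mathcomp Require Import classical_sets.
From mathcomp Require Import ssrint boolp zify.

Local Open Scope classical_set_scope.

(** * Shellings and the exchange property *)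

Section Shellings.
Set Implicit Arguments. Unset Strict Implicit. Unset Printing Implicit Defensive.
Variable V : choiceType.
Implicit Types (X : set {fset V}) (K : complex V) (A B C F G s : {fset V}).

(** Induction on the gap between the cardinality of [s] and [d]. [X] is a bare family of sets, so
    that the intersections in the definition of a shelling are covered too. *)
Lemma face_sub_facet X d s :
  (forall t, X t -> #|` t| <= d)%N -> X s -> exists2 F, facets X F & (s `<=` F)%fset.
Proof.
move=> Xd; have [n] := ubnP (d - #|` s|)%N.
elim: n s => // n IHn s ltn Xs.
have [sF|/not_andP[//|]] := pselect (facets X s); first by exists s.
move=> /existsNP[G /not_implyP[XG /not_implyP[sG /eqP neq]]].
have sGp : (s `<` G)%fset by rewrite fproperEneq neq.
have ltsG := fproper_ltn_card sGp.
have ltGd := Xd _ XG.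
have [|//|F FF GF] := IHn G; first by move: ltn ltsG ltGd; lia.
by exists F => //; apply: fsubset_trans GF.
Qed.

Lemma complex_face_sub_facet K s : faces K s -> exists2 F, facets K F & (s `<=` F)%fset.
Proof. by have [d dP] := complex_findim K; apply: face_sub_facet dP. Qed.

Lemma cardfsD1_mem (F : {fset V}) x : x \in F -> #|` F| = #|` (F `\ x)%fset|.+1.
Proof. by move=> xF; rewrite (cardfsD1 x) xF. Qed.

Lemma fsubsetD1_mem (F G : {fset V}) :
  (G `<=` F)%fset -> #|` F| = #|` G|.+1 -> exists2 x, x \in F & G = (F `\ x)%fset.
Proof.
move=> GF cF.
have /fsubsetPn[x xF xG] : ~~ (F `<=` G)%fset.
  by apply/negP => /fsubset_leq_card; rewrite cF ltnn.
exists x => //; apply/eqP; rewrite eqEfcard; apply/andP; split.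
  by rewrite fsubsetD1 GF.
by move: cF; rewrite (cardfsD1_mem xF) => -[->].
Qed.

(** The intersection of [A] and [B] extends to a facet [G] of the intersection complex at [B].
    Purity and dimension give [G] one element less than [B], so [G] is [B] minus some [x], and it
    lies in an earlier facet [C]. An [x] in [A] would lie in [G]. *)
Lemma shelling_exchange K Fs A B : shelling K Fs -> facets K A -> facets K B ->
  (index A Fs < index B Fs)%N ->
  exists C x, [/\ facets K C, (index C Fs < index B Fs)%N, x \in B, x \notin A
                & (B `\ x `<=` C)%fset].
Proof.
move=> [uFs FsE shP] KA KB ltAB.
have inFs F : facets K F -> F \in Fs by rewrite -FsE.
have FsK F : F \in Fs -> facets K F by rewrite -FsE.
have := shP (index B Fs); rewrite index_mem inFs // (leq_ltn_trans _ ltAB) //=.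
rewrite nth_index ?inFs // => /(_ isT).
set X := (X in pure X) => -[pX [[s Xs cs] Xle]].
have Xd t : X t -> (#|` t| <= #|` s|)%N by move=> /Xle; rewrite -cs; lia.
have XAB : X (A `&` B)%fset.
  split; last exact: fsubsetIr.
  by exists (index A Fs) => //=; rewrite nth_index ?inFs //; apply: fsubsetIl.
have [G GX ABG] := face_sub_facet Xd XAB.
have [S SX sS] := face_sub_facet Xd Xs.
have cG : #|` B| = #|` G|.+1.
  rewrite (pX _ _ GX SX).
  move: cs (Xd _ SX.1) (fsubset_leq_card sS); lia.
have [[i /= ltiB Gi] GB] := GX.1.
have [x xB eG] := fsubsetD1_mem GB cG.
have lti : (i < size Fs)%N by apply: ltn_trans ltiB _; rewrite index_mem inFs.
exists (nth fset0 Fs i), x; split => //.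
- by apply/FsK/mem_nth.
- by rewrite index_uniq.
- apply/negP => xA; have /fsubsetP/(_ x) := ABG.
  by rewrite inE xA xB eG !inE eqxx => /(_ isT).
- by rewrite -eG.
Qed.

(** Sorting the facets by [r] gives a shelling. The exchange is required for equal ranks as well, so
    ties may fall in any order. [Fs] guarantees finitely many facets. *)
Lemma shellable_rank K (Fs : seq {fset V}) (r : {fset V} -> nat) :
  (forall F, facets K F -> F \in Fs) ->
  (forall A B, facets K A -> facets K B -> A <> B -> (r A <= r B)%N ->
    exists C x, [/\ facets K C, (r C < r B)%N, x \in B, x \notin A
                  & (B `\ x `<=` C)%fset]) ->
  shellable K.
Proof.
move=> KFs exch.
pose leT := relpre r leq.
have totT : total leT by move=> A B; apply: leq_total.
have reT : reflexive leT by move=> A; apply: leqnn.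
have trT : transitive leT by move=> A B C; apply: leq_trans.
pose Gs := sort leT [seq F <- undup Fs | `[< facets K F >]].
have uGs : uniq Gs by rewrite sort_uniq filter_uniq ?undup_uniq.
have GsP F : (F \in Gs) = `[< facets K F >].
  rewrite mem_sort mem_filter mem_undup.
  by case: asboolP => //= /KFs ->.
have sGs : sorted leT Gs by apply: sort_sorted.
exists Gs; split => //.
  by apply/seteqP; split=> F /=; rewrite GsP => /asboolP.
move=> k /andP[k0 ltk] /=.
set B := nth _ _ k; set X := _ `&` _.
have KG i : (i < size Gs)%N -> facets K (nth fset0 Gs i).
  by move=> lti; apply/asboolP; rewrite -GsP mem_nth.
have KB : facets K B by apply: KG.
(* Every simplex of [X] lies in a simplex of [X] of the form [B] minus a point. The facets of [X]
   are therefore of this form, which yields both purity and dimension. *)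
have XD1 s : X s -> exists x, [/\ x \in B, X (B `\ x)%fset & (s `<=` B `\ x)%fset].
  move=> [[i /= ltik si] sB]; have lti := ltn_trans ltik ltk.
  have neq : nth fset0 Gs i <> B.
    by move/eqP; rewrite nth_uniq // => /eqP eik; move: ltik; rewrite eik ltnn.
  have rle : (r (nth fset0 Gs i) <= r B)%N.
    exact: (sorted_leq_nth trT reT fset0 sGs i k lti ltk (ltnW ltik)).
  have [C [x [KC ltC xB xA BC]]] := exch _ _ (KG _ lti) KB neq rle.
  have CGs : C \in Gs by rewrite GsP; apply/asboolP.
  exists x; split => //; last first.
    rewrite fsubsetD1 sB; apply: contra xA => /(fsubsetP si) //.
  split; last exact: fsubD1set.
  exists (index C Gs) => /=; last by rewrite nth_index.
  rewrite ltnNge; apply/negP => leC.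
  have : (r B <= r C)%N.
    rewrite -(nth_index fset0 CGs).
    by apply: (sorted_leq_nth trT reT fset0 sGs k _ ltk _ leC); rewrite inE index_mem.
  by rewrite leqNgt ltC.
have Xcard s : X s -> (#|` s| < #|` B|)%N.
  by move=> /XD1[x [xB _ /fsubset_leq_card]]; rewrite (cardfsD1_mem xB).
have XF s : facets X s -> #|` B| = #|` s|.+1.
  move=> [/XD1[x [xB XBx sBx]] smax].
  by rewrite (cardfsD1_mem xB) (smax _ XBx sBx).
split; first by move=> F G /XF + /XF => -> [].
split; last by move=> s /Xcard; lia.
(* As [k] is positive, [X] contains the empty simplex; a simplex above it attains the dimension. *)
have : X fset0 by split; [exists 0%N => //; apply: fsub0set|apply: fsub0set].
move=> /XD1[x [xB XBx _]]; exists (B `\ x)%fset => //.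
by rewrite (cardfsD1_mem xB); lia.
Qed.

End Shellings.

(** * Simplices of a join as families of components *)

Section Glue.
Set Implicit Arguments. Unset Strict Implicit. Unset Printing Implicit Defensive.
Variables (m : nat) (V : 'I_m -> choiceType).
Implicit Types (s t : {fset {i : 'I_m & V i}}) (f : forall i, {fset V i}).

Definition glue f : {fset {i : 'I_m & V i}} :=
  [fset u in flatten [seq [seq Tagged V v | v <- f i] | i <- enum 'I_m]]%fset.

Lemma in_glue f i (v : V i) : (Tagged V v \in glue f) = (v \in f i).
Proof.
rewrite inE /=; apply/flatten_mapP/idP => [[j _ /mapP[w wf e]]|vf]; last first.
  by exists i; rewrite ?mem_enum // map_f.
have eij : i = j by have := congr1 tag e.
by case: _ / eij w wf e => w wf /eqP; rewrite eq_Tagged => /eqP /= ->.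
Qed.

Lemma slice_glue f i : slice i (glue f) = f i.
Proof. by apply/fsetP => v; rewrite in_slice in_glue. Qed.

Lemma fsub_slices s t : (forall i, slice i s `<=` slice i t)%fset -> (s `<=` t)%fset.
Proof.
move=> st; apply/fsubsetP => -[i v].
by have /fsubsetP/(_ v) := st i; rewrite !in_slice.
Qed.

Lemma eq_slices s t : (forall i, slice i s = slice i t) -> s = t.
Proof. by move=> st; apply/eqP; rewrite eqEfsubset !fsub_slices // => i; rewrite st. Qed.

End Glue.

(** * Facets of the polyhedral join *)

Section PolyhedralJoinFacets.
Set Implicit Arguments. Unset Strict Implicit. Unset Printing Implicit Defensive.
Variables (m : nat) (M : complex 'I_m) (V : 'I_m -> choiceType).
Variables K L : forall i : 'I_m, complex (V i).
Hypothesis LK : forall i, faces (L i) `<=` faces (K i).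
Hypothesis L_facetK : forall i s, faces (L i) s -> ~ facets (K i) s.

(** For the converse, let a face [t] over [T] contain [s]. At an index of [S] outside [T], a facet
    of [K i] would lie in, hence equal, a face of [L i], against [L_facetK]. So [T] contains [S],
    and maximality gives equality of supports, then of components. *)
Lemma poly_join_facets s :
  facets (poly_join M K L) s <->
  exists2 S, facets M S &
    forall i, facets (if i \in S then K i else L i) (slice i s).
Proof.
split=> [[[S0 MS0 S0s] smax]|[S [MS Smax] Ss]].
  have [S MS S0S] := complex_face_sub_facet MS0.
  have facei i : faces (if i \in S then K i else L i) (slice i s).
    have := S0s i; case: ifP => [/(fsubsetP S0S) -> //|_].
    by case: ifP => // _; apply: LK.
  exists S => // i; split => // G XG sG.
  (* Enlarging the single component at [i] to [G] gives a face containing [s]. *)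
  pose f := dfwith (fun j => slice j s) G.
  have -> : s = glue f.
    apply: smax.
      exists S; first exact: MS.1.
      move=> j; rewrite slice_glue /f.
      by case: dfwithP.
    apply: fsub_slices => j; rewrite slice_glue /f.
    by case: dfwithP.
  by rewrite slice_glue /f dfwith_in.
split.
  by exists S => // i; have [] := Ss i.
move=> t [T MT Tt] st.
have ST : (S `<=` T)%fset.
  apply/fsubsetP => i iS; apply/negPn/negP => /negPf iT.
  have := Tt i; rewrite iT => Lt; have := Ss i; rewrite iS => Ks.
  have := Ks.2 _ (LK Lt) (slice_sub i st) => e.
  by apply: (L_facetK Lt); rewrite -e.
have eST := Smax _ MT ST; subst T.
by apply: eq_slices => i; apply: (Ss i).2 (Tt i) (slice_sub i st).
Qed.

(** The label types may be infinite; the finite lists of facets of the [K i] are what bounds the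
    faces and makes the facets of the join enumerable. *)
Lemma poly_join_facets_bounded (Fs : forall i, seq {fset V i}) :
  (forall i F, facets (K i) F -> F \in Fs i) ->
  exists U : {fset {i : 'I_m & V i}}, forall s, faces (poly_join M K L) s -> (s `<=` U)%fset.
Proof.
move=> FsP; exists (glue (fun i => [fset v in flatten (map (@enum_fset _) (Fs i))]%fset)).
move=> s /(poly_join_sub LK) Ks; apply: fsub_slices => i; rewrite slice_glue.
have [F KF sF] := complex_face_sub_facet (Ks i).
apply: fsubset_trans sF _; apply/fsubsetP => v vF; rewrite inE /=.
by apply/flattenP; exists (enum_fset F) => //; apply/map_f/FsP.
Qed.

End PolyhedralJoinFacets.

(** * The ordering of the facets and its exchange property *)

Section PolyhedralJoinShelling.
Set Implicit Arguments. Unset Strict Implicit. Unset Printing Implicit Defensive.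
Variables (m : nat) (M : complex 'I_m) (V : 'I_m -> choiceType).
Variables K L : forall i : 'I_m, complex (V i).
Variables (Ms : seq {fset 'I_m}) (Fs : forall i, seq {fset V i}).
Variable alpha : forall i, {fset V i}.
Hypothesis LK : forall i, faces (L i) `<=` faces (K i).
Hypothesis facetL : forall i,
  facets (L i) `<=` [set (alpha i `\ x)%fset | x in [set` alpha i]].
Hypothesis shM : shelling M Ms.
Hypothesis shK : forall i, shelling (K i) (Fs i).
Hypothesis minK : forall i, shelling_min (K i) (Fs i) (alpha i).

Local Notation Z := (poly_join M K L).
Local Notation X S i := (if i \in S then K i else L i).
Implicit Types (A B C s : {fset {i : 'I_m & V i}}) (S : {fset 'I_m}).

Lemma facetsK_Fs i F : facets (K i) F -> F \in Fs i.
Proof. by have [_ <- _] := shK i. Qed.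

Lemma facetsM_Ms S : facets M S -> S \in Ms.
Proof. by have [_ <- _] := shM. Qed.

Lemma facetsL_D1 i F : facets (L i) F -> exists2 x, x \in alpha i & F = (alpha i `\ x)%fset.
Proof. by move=> /facetL[x xa <-]; exists x. Qed.

(** Such a face misses a point of [alpha i], so it lies properly inside that facet. *)
Lemma L_not_facetK i (s : {fset V i}) : faces (L i) s -> ~ facets (K i) s.
Proof.
move=> /complex_face_sub_facet[F /facetsL_D1[x xa ->] sax] [_ smax].
have [[Ka _] _] := minK i.
have sa : s = alpha i by apply: smax Ka (fsubset_trans sax (fsubD1set _ _)).
by move: sax; rewrite sa fsubsetD1 xa andbF.
Qed.

(** Recovers the facet of [M] from which a facet of the join comes: by [L_not_facetK], components
    from [K i] and from [L i] cannot be confused. *)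
Definition facet_supp s : {fset 'I_m} :=
  [fset i in enum 'I_m | `[< facets (K i) (slice i s) >]]%fset.

Lemma facet_supp_uniq S s :
  (forall i, facets (X S i) (slice i s)) -> facet_supp s = S.
Proof.
move=> Ss; apply/fsetP => i; rewrite !inE mem_enum /=.
have := Ss i; case: ifP => _ Xs; first exact/asboolP.
by apply/asboolP; apply: L_not_facetK; apply: Xs.1.
Qed.

Lemma facets_suppP s : facets Z s ->
  facets M (facet_supp s) /\ forall i, facets (X (facet_supp s) i) (slice i s).
Proof.
by move=> /(poly_join_facets _ LK L_not_facetK)[S MS Ss]; rewrite (facet_supp_uniq Ss).
Qed.

Lemma facets_glue S (f : forall i, {fset V i}) :
  facets M S -> (forall i, facets (X S i) (f i)) ->
  facets Z (glue f) /\ facet_supp (glue f) = S.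
Proof.
move=> MS Sf; have Ss i : facets (X S i) (slice i (glue f)) by rewrite slice_glue.
split; last exact: facet_supp_uniq.
by apply/(poly_join_facets _ LK L_not_facetK); exists S.
Qed.

(* Facets of [L i] are subsets of [alpha i], so that appending its powerset to
   [Fs i] ranks the facets of both [K i] and [L i] injectively. *)
Definition ranking i : seq {fset V i} := Fs i ++ enum_fset (fpowerset (alpha i)).
Definition rank i (F : {fset V i}) : nat := index F (ranking i).

Lemma mem_ranking S i F : facets (X S i) F -> F \in ranking i.
Proof.
rewrite mem_cat; case: ifP => _; first by move=> /facetsK_Fs ->.
by move=> /facetsL_D1[x _ ->]; rewrite (fpowersetE (alpha i)) fsubD1set orbT.
Qed.

(** Distinct facets of [L i] are [alpha i] minus [x] and minus [y], so [F] itself serves as [H]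
    whatever the order. On facets of [K i] the rank is the position in [Fs i], which comes first in
    [ranking]. *)
Lemma rank_exchange S i F G : facets (X S i) F -> facets (X S i) G ->
  (rank F < rank G)%N ->
  exists H x, [/\ facets (X S i) H, (rank H < rank G)%N, x \in G, x \notin F
                & (G `\ x `<=` H)%fset].
Proof.
case: ifP => iS XF XG ltFG; last first.
  have [x xa eF] := facetsL_D1 XF; have [y ya eG] := facetsL_D1 XG.
  have neq : x != y by apply: contraTneq ltFG => exy; rewrite eF eG exy ltnn.
  exists F, x; split=> //; first by rewrite eG !inE neq xa.
    by rewrite eF !inE eqxx.
  by rewrite eF eG fsetDDl fsetUC -fsetDDl fsubD1set.
have rankE H : facets (K i) H -> rank H = index H (Fs i).
  by move=> /facetsK_Fs iH; rewrite /rank index_cat iH.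
move: ltFG; rewrite !rankE // => /(shelling_exchange (shK i) XF XG).
by move=> [H [x [KH ltH xG xF GH]]]; exists H, x; rewrite rankE.
Qed.

(** Exceeds every sum of ranks, which makes [key] a lexicographic order. *)
Definition weight : nat := (\sum_(i < m) size (ranking i)).+1.
Definition key s : nat :=
  index (facet_supp s) Ms * weight + \sum_(i < m) rank (slice i s).

Lemma key_supp_lt A B :
  (index (facet_supp A) Ms < index (facet_supp B) Ms)%N -> (key A < key B)%N.
Proof.
move=> ltAB; rewrite /key.
apply: (@leq_trans ((index (facet_supp A) Ms).+1 * weight)).
  by rewrite mulSnr ltn_add2l ltnS; apply: leq_sum => i _; apply: index_size.
by rewrite (leq_trans (leq_mul ltAB (leqnn _))) ?leq_addr.
Qed.

Lemma fsubD1_glue B v (x : V v) (f : forall i, {fset V i}) :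
  (forall i, i != v -> slice i B `<=` f i)%fset -> (slice v B `\ x `<=` f v)%fset ->
  (B `\ Tagged V x `<=` glue f)%fset.
Proof.
move=> Bf Bv; apply/fsubsetP => -[i w]; rewrite in_fsetD1 -/(Tagged V w) in_glue -in_slice.
have [eiv|niv] := eqVneq i v; last by move=> /andP[_ /(fsubsetP (Bf i niv))].
move: w; case: v / eiv x Bf Bv => x Bf Bv w; rewrite eq_Tagged /= => wB.
by apply: (fsubsetP Bv); rewrite in_fsetD1.
Qed.

Lemma facet_update B v (H : {fset V v}) : facets Z B ->
  facets (X (facet_supp B) v) H -> (rank H < rank (slice v B))%N ->
  let C := glue (dfwith (fun i => slice i B) H) in
  facets Z C /\ (key C < key B)%N.
Proof.
move=> ZB XH ltH C; have [MB XB] := facets_suppP ZB.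
have [|ZC sC] := @facets_glue _ (dfwith (fun i => slice i B) H) MB.
  by move=> i; case: dfwithP => // j _; apply: XB.
split=> //; rewrite /key sC ltn_add2l (bigD1 v) // [ltnRHS](bigD1 v) //=.
rewrite slice_glue dfwith_in -addSn leq_add //; apply: leq_sum => i niv.
by rewrite slice_glue dfwith_out // eq_sym.
Qed.

Lemma key_exchange A B : facets Z A -> facets Z B -> A <> B ->
  (key A <= key B)%N ->
  exists C x, [/\ facets Z C, (key C < key B)%N, x \in B, x \notin A
                & (B `\ x `<=` C)%fset].
Proof.
move=> ZA ZB neAB leAB.
have [MA XA] := facets_suppP ZA; have [MB XB] := facets_suppP ZB.
(* Exchange in the component [v] alone. [F] may be larger than the component of [A], so that
   [alpha v] can be used as well. *)
have exch v F : (slice v A `<=` F)%fset -> facets (X (facet_supp B) v) F ->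
    (rank F < rank (slice v B))%N ->
  exists C x, [/\ facets Z C, (key C < key B)%N, x \in B, x \notin A
                & (B `\ x `<=` C)%fset].
  move=> AF XF ltF; have [H [x [XH ltH xB xF BH]]] := rank_exchange XF (XB v) ltF.
  have [ZC ltC] := facet_update ZB XH ltH.
  eexists; exists (Tagged V x); split; [exact: ZC|exact: ltC|..].
  - by rewrite -in_slice.
  - by rewrite -in_slice; apply: contra xF; apply: (fsubsetP AF).
  - apply: fsubD1_glue => [i niv|]; last by rewrite dfwith_in.
    by rewrite dfwith_out // eq_sym.
have [ltS|] := ltnP (index (facet_supp A) Ms) (index (facet_supp B) Ms); last first.
  rewrite leq_eqVlt => /orP[/eqP eS|/key_supp_lt]; last by rewrite ltnNge leAB.
  have {eS} eS : facet_supp A = facet_supp B.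
    by apply/esym; move: eS; apply: (index_inj fset0); apply: facetsM_Ms.
  have [v ltv] : exists v, (rank (slice v A) < rank (slice v B))%N.
    apply/not_existsP => geAB; apply: neAB; apply: eq_slices => i.
    have leBA j : true -> (rank (slice j B) <= rank (slice j A))%N.
      by move=> _; rewrite leqNgt; apply/negP/geAB.
    (* The keys give one inequality between the sums and [leBA] the other. Equality of the sums
       forces equality of each rank, hence of each component. *)
    have : (\sum_(j < m) rank (slice j B) == \sum_(j < m) rank (slice j A))%N.
      by move: leAB; rewrite /key eS leq_add2l eqn_leq (@leq_sum _ (index_enum _) xpredT _ _ leBA) => ->.
    rewrite (leqif_sum (fun j jT => leqif_eq (leBA j jT))).
    move=> /forall_inP/(_ i isT)/eqP eBA; apply/esym.
    exact: (@index_inj _ fset0 (ranking i)) (mem_ranking (XB i)) (mem_ranking (XA i)) eBA.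
  by apply: (exch v) ltv => //; rewrite -eS.
have [S [v [MS ltSB vB vA BS]]] := shelling_exchange shM MA MB ltS.
(* Otherwise [S] would contain the whole support of [B] and equal it by maximality. *)
have vS : v \notin S.
  apply: contraTN ltSB => vS; rewrite (MB.2 _ MS.1) ?ltnn //.
  by rewrite -(fsetD1K vB) fsubUset fsub1set vS.
have [x xa eA] : exists2 x, x \in alpha v & slice v A = (alpha v `\ x)%fset.
  by apply: facetsL_D1; have := XA v; rewrite (negPf vA).
have Kv : facets (K v) (slice v B) by have := XB v; rewrite vB.
have [eB|neB] := eqVneq (slice v B) (alpha v); last first.
  have [Ka mina] := minK v.
  apply: (exch v (alpha v)); rewrite ?vB ?eA ?fsubD1set //.
  (* Minimality of [alpha v] gives the weak inequality; [neB] and injectivity of positions make it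
     strict. *)
  rewrite /rank /ranking !index_cat !facetsK_Fs // ltn_neqAle.
  apply/andP; split; last exact: mina.
  apply: contra_neq neB => e; apply/esym; move: e.
  by apply: (index_inj fset0); apply: facetsK_Fs.
pose f i := if i == v then slice i A
  else if (i \in S) && (i \notin facet_supp B) then alpha i else slice i B.
have [|ZC sC] := @facets_glue _ f MS.
  (* Every index of the support of [B] other than [v] lies in [S], so there the component of [B] is
     still of the right kind. *)
  move=> i; rewrite /f; case: eqVneq => [->|niv].
    by rewrite (negPf vS); have := XA v; rewrite (negPf vA).
  have := XB i; case: (boolP (i \in facet_supp B)) => iB.
    by rewrite andbF (fsubsetP BS) // in_fsetD1 niv.
  by rewrite andbT; case: ifP => // _ _; have [] := minK i.
exists (glue f), (Tagged V x); split=> //.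
- by apply: key_supp_lt; rewrite sC.
- by rewrite -in_slice eB.
- by rewrite -in_slice eA !inE eqxx.
- apply: fsubD1_glue => [i niv|]; last by rewrite /f eqxx eA eB.
  rewrite /f (negPf niv); case: ifP => // /andP[_ iB].
  have := XB i; rewrite (negPf iB) => /facetsL_D1[y _ ->].
  exact: fsubD1set.
Qed.

Lemma poly_join_shellable : shellable Z.
Proof.
have [U UP] := poly_join_facets_bounded M LK (@facetsK_Fs).
apply: (@shellable_rank _ _ (enum_fset (fpowerset U)) key _ key_exchange).
by move=> F [/UP FU _]; rewrite (fpowersetE U).
Qed.

End PolyhedralJoinShelling.

Theorem theorem4p3 (m : nat) (hm : (0 < m)%N)
    (M : complex 'I_m) (hM : vertices M = [set: 'I_m])
    (V : 'I_m -> choiceType) (K L : forall i : 'I_m, complex (V i))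
    (hLK : forall i : 'I_m, faces (L i) `<=` faces (K i))
    (shM : shellable M)
    (shK : forall i : 'I_m, exists alpha : {fset V i},
      [/\ facets (K i) alpha,
          facets (L i) `<=` [set (alpha `\ x)%fset | x in [set` alpha]] &
          exists Fs : seq {fset V i},
            shelling (K i) Fs /\ shelling_min (K i) Fs alpha]) :
  shellable (poly_join M K L).
Proof.
have [Ms shMs] := shM.
(* The facet and its shelling are chosen together, since the shelling depends on the facet. *)
have /all_sig[w wP] i : {w : {fset V i} * seq {fset V i} |
    [/\ facets (L i) `<=` [set (w.1 `\ x)%fset | x in [set` w.1]],
        shelling (K i) w.2 & shelling_min (K i) w.2 w.1]}.
  by apply: cid; have [alpha [_ La [Fs [? ?]]]] := shK i; exists (alpha, Fs).
by apply: (@poly_join_shellable _ _ _ _ _ Ms (fun i => (w i).2) (fun i => (w i).1)) => // i;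
  have [] := wP i.
Qed.
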